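(* For $m\ge0$ define the $m\times m$ tridiagonal matrix $$C_m(q)=\begin{pmatrix} d_1(q)&1&&&0\\ -c_2(q)&d_2(q)&1&&\\ &-c_3(q)&d_3(q)&\ddots&\\ &&\ddots&\ddots&1\\ 0&&&-c_m(q)&d_m(q) \end{pmatrix},$$ i.e. with diagonal entries $d_1(q),\dots,d_m(q)$, all superdiagonal entries equal to $1$, subdiagonal entry $-c_i(q)$ in row $i$ and column $i-1$ for $2\le i\le m$, and all other entries $0$. Then for all $n\ge0$, $$\alpha_n(q)=\det C_n(q),$$ where by convention $\det C_0(q)=1$.
   Context: For $n\ge1$, $d_n(q)=1+q-q^n$ and $c_n(q)=q^{2n-1}+q^n-q$. The polynomials $\alpha_n(q)=\widehat F^{(n)}_0(q)$ and $\beta_n(q)=\widehat F^{(n)}_1(q)$ ($n\ge0$) are defined by $\alpha_0=1$, $\beta_0=0$ and, for $n\ge1$, $$\alpha_n=\alpha_{n-1}+q^n\beta_{n-1},\qquad \beta_n=q^n\alpha_{n-1}+(1-q^n)\beta_{n-1}.$$ *)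

(* Defs.v *)
From mathcomp Require Import all_boot all_order all_algebra.

Set Implicit Arguments.
Unset Strict Implicit.
Unset Printing Implicit Defensive.

Import GRing.Theory.
Local Open Scope ring_scope.

(* The indeterminate q is 'X in Z[q] = {poly int}. *)

Definition d (n : nat) : {poly int} := 1 + 'X - 'X^n.

(* Meant for n >= 1 only: the exponent 2 * n - 1 is truncated at n = 0. *)
Definition c (n : nat) : {poly int} := 'X^(2 * n - 1) + 'X^n - 'X.

Fixpoint alpha (n : nat) : {poly int} :=
  match n with
  | 0 => 1
  | k.+1 => alpha k + 'X^(k.+1) * beta k
  end
with beta (n : nat) : {poly int} :=
  match n with
  | 0 => 0
  | k.+1 => 'X^(k.+1) * alpha k + (1 - 'X^(k.+1)) * beta k
  end.

(* Ordinals start at 0, so i : 'I_m stands for the row or column i + 1. *)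
Definition C (m : nat) : 'M[{poly int}]_m :=
  \matrix_(i < m, j < m)
    if j == i :> nat then d i.+1
    else if j == i.+1 :> nat then 1
    else if i == j.+1 :> nat then - c i.+1
    else 0.

(* Main.v *)
Require Import Defs.
From mathcomp Require Import all_boot all_order all_algebra.
From mathcomp Require Import zify ring.

Import GRing.Theory.
Local Open Scope ring_scope.

(** Eliminating [beta] from the defining recursion shows that [alpha] satisfies
    alpha_(n+2) = d_(n+2) alpha_(n+1) + c_(n+2) alpha_n, which is the three-term
    recurrence of the tridiagonal determinants det C_n. *)

Definition tridiag {R : comPzRingType} (a b e : nat -> R) (m : nat) : 'M[R]_m :=
  \matrix_(i < m, j < m)
    if j == i :> nat then a i
    else if j == i.+1 :> nat then b i
    else if i == j.+1 :> nat then e i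
    else 0.

(** Laplace expansion along the last row, which has only two nonzero entries; the minor of the
    subdiagonal one is then expanded along its last column. *)
Lemma det_tridiag_rec (R : comPzRingType) (a b e : nat -> R) (n : nat) :
  \det (tridiag a b e n.+2)
    = a n.+1 * \det (tridiag a b e n.+1)
      - b n * e n.+1 * \det (tridiag a b e n).
Proof.
have lift_maxE m (i : 'I_m) : lift ord_max i = i :> nat by rewrite lift_max.
rewrite (expand_det_row _ ord_max) !big_ord_recr /= big1 ?add0r; last first.
  by move=> i _; rewrite mxE /= !ifN ?mul0r //; have := ltn_ord i; lia.
rewrite !mxE /= !eqxx !ifN; [|lia..].
rewrite addrC; congr (_ + _).
  rewrite /cofactor -signr_odd oddD addbb expr0 mul1r; congr (_ * \det _).
  by apply/matrixP => i j; rewrite !mxE !lift_maxE.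
rewrite /cofactor addSn -signr_odd /= oddD addbb expr1.
(* The last column of this minor is the original column [n.+1], where only [b n], in the bottom row,
   survives. *)
rewrite (expand_det_col _ ord_max) big_ord_recr /= big1 ?add0r; last first.
  move=> i _; rewrite !mxE /= !ifN ?mul0r //; rewrite /bump /=;
  have := ltn_ord i; lia.
rewrite !mxE /= /bump !leqnn ltnn /= add1n add0n eqxx ifN; last by lia.
rewrite /cofactor -signr_odd oddD addbb expr0 mul1r.
rewrite mulN1r mulrN mulrA (mulrC (e _)); congr (- (_ * \det _)).
(* Rows and columns [n] and [n.+1] are gone, so the index shifts act trivially below [n]. *)
apply/matrixP => i j; rewrite !mxE /= /bump /=.
have [ltin ltjn] := (ltn_ord i, ltn_ord j).
have -> : (n <= i)%N = false by lia.
have -> : (n <= j)%N = false by lia.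
have -> : (n.+1 <= i)%N = false by lia.
by have -> : (n <= 0 + j)%N = false by lia.
Qed.

(** In ['X^(n.+2) * beta n.+1], unfold [beta n.+1] and replace ['X^(n.+1) * beta n] by
    [alpha n.+1 - alpha n]; no division is required. *)
Lemma alpha_rec (n : nat) :
  alpha n.+2 = d n.+2 * alpha n.+1 + c n.+2 * alpha n.
Proof.
(* Removing the truncated subtraction lets every exponent split into powers of ['X] and ['X^n]. *)
rewrite /d /c (_ : (2 * n.+2 - 1 = n.+1 + n.+2)%N); last by lia.
by rewrite /= !exprD !exprS; ring.
Qed.

Lemma det_C_rec (n : nat) :
  \det (C n.+2) = d n.+2 * \det (C n.+1) + c n.+2 * \det (C n).
Proof.
have CE m : C m = tridiag (fun i => d i.+1) (fun=> 1) (fun i => - c i.+1) m by [].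
by rewrite !CE det_tridiag_rec mul1r mulNr opprK.
Qed.

Theorem proposition4 (n : nat) : alpha n = \det (C n).
Proof.
(* The recurrence has order two, so the induction carries two consecutive values. *)
suff [] : alpha n = \det (C n) /\ alpha n.+1 = \det (C n.+1) by [].
elim: n => [|n [IH0 IH1]].
  by rewrite det_mx00 det_mx11 mxE /= /d mulr0 addr0 expr1 addrK.
by rewrite alpha_rec det_C_rec IH0 IH1.
Qed.
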